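(* Let $\alpha>-1$, $1<p\le q<\infty$, and $\Phi\in B_p$. Let $\mu$ be a positive measure on $\mathcal H$ and $\omega$ a weight such that there is a positive constant $C_1$ such that for any interval $I\subset\mathbb R$, $$\mu(Q_I)\le C_1|Q_I|_{\omega,\alpha}^{q/p}.$$ Then there is a constant $C_2>0$ such that for any function $f$, $$\left(\int_{\mathcal H}\left(\mathcal{M}_{\Phi,\alpha}f(z)\right)^q d\mu(z)\right)^{1/q}\le C_2\left(\int_{\mathcal H}|f(z)|^p\,\mathcal{M}_\alpha\omega(z)\,dV_\alpha(z)\right)^{1/p}.$$
   Context: $\mathcal H=\{z=x+iy\in\mathbb C: x\in\mathbb R,\ y>0\}$ is the upper-half plane and $dV_\alpha(x+iy)=y^\alpha\,dx\,dy$. A weight is a nonnegative locally integrable function on $\mathcal H$. Functions $f$ are measurable on $\mathcal H$. Intervals $I\subset\mathbb R$ are bounded and of positive length $|I|$; the Carleson square of $I$ is $Q_I=\{x+iy: x\in I,\ 0<y<|I|\}$. For $E\subset\mathcal H$ measurable, $|E|_{\omega,\alpha}=\int_E\omega\,dV_\alpha$ and $|E|_\alpha=\int_E dV_\alpha$. A Young function is a function $\Phi:[0,\infty)\to[0,\infty)$ that is continuous, convex and increasing, with $\Phi(0)=0$ and $\Phi(t)\to\infty$ as $t\to\infty$; throughout, $\Phi(1)=1$. For $1<p<\infty$, $\Phi\in B_p$ means that $\Phi$ is a Young function satisfying the $\Delta_2$ condition (there is $K>1$ with $\Phi(2t)\le K\Phi(t)$ for all $t\ge0$) and there is $c>0$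 with $\int_c^\infty\frac{\Phi(t)}{t^p}\frac{dt}{t}<\infty$. Luxembourg norm: $\|f\|_{Q_I,\Phi,\alpha}=\inf\{\lambda>0:\frac{1}{|Q_I|_\alpha}\int_{Q_I}\Phi\left(\frac{|f(z)|}{\lambda}\right)dV_\alpha(z)\le1\}$. Maximal functions: $\mathcal{M}_{\Phi,\alpha}f(z)=\sup\|f\|_{Q_I,\Phi,\alpha}$, the supremum being over all intervals $I\subset\mathbb R$ with $z\in Q_I$; and $\mathcal{M}_\alpha\omega(z)=\sup_{I\subset\mathbb R}\frac{\chi_{Q_I}(z)}{|Q_I|_\alpha}\int_{Q_I}\omega\,dV_\alpha$. *)

(* Defs.v *)
From HB Require Import structures.
From mathcomp Require Import all_boot all_order all_algebra.
From mathcomp Require Import all_classical all_reals all_analysis.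
From mathcomp Require Import complex.

Set Implicit Arguments.
Unset Strict Implicit.
Unset Printing Implicit Defensive.

Import Order.TTheory GRing.Theory Num.Theory.
Import numFieldNormedType.Exports.

Local Open Scope classical_set_scope.
Local Open Scope ring_scope.

(* The complex number x + iy, as a point of the domain, is the pair (x, y) of
   the product (Borel) measurable space.  Functions on the upper half-plane are
   total functions on the plane, of which only the restriction to [upper_half]
   is ever used. *)
Notation plane R := (measurableTypeR R * measurableTypeR R)%type.

Section HalfPlane.
Context {R : realType}.
Implicit Types (alpha p r : R) (Phi : R -> R) (I : set R).

Definition upper_half : set (plane R) := [set z | 0 < z.2].

Definition area : {measure set (plane R) -> \bar R} :=
  (lebesgue_measure \x lebesgue_measure)%E.

Definition intV alpha (E : set (plane R)) (g : plane R -> \bar R) : \bar R :=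
  (\int[area]_(z in E) (g z * (z.2 `^ alpha)%:E))%E.

Definition V alpha (E : set (plane R)) : \bar R := intV alpha E (cst 1%E).

Definition Vw (w : plane R -> R) alpha (E : set (plane R)) : \bar R :=
  intV alpha E (EFin \o w).

(* Local integrability refers to the open set [upper_half]: integrability up to
   the boundary line is not required. *)
Record weight (w : plane R -> R) : Prop := Weight {
  weight_ge0 : forall z, upper_half z -> 0 <= w z;
  weight_measurable : measurable_fun upper_half w;
  weight_locint : forall K : set (R * R), compact K -> K `<=` upper_half ->
    area.-integrable K (EFin \o w)
}.

Definition measurable_cfun (D : set (plane R)) (f : plane R -> R[i]) : Prop :=
  measurable_fun D (fun z => complex.Re (f z) : R) /\
  measurable_fun D (fun z => complex.Im (f z) : R).

(* The norm of R[i] takes its values in R[i]. *)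
Definition modulus (u : R[i]) : R := complex.Re `|u|.

(* Endpoints may or may not belong to the interval. *)
Definition nondeg_interval I : Prop :=
  [/\ is_interval I, bounded_set I & (0 < lebesgue_measure I)%E].

Definition carleson I : set (plane R) :=
  [set z | I z.1 /\ 0 < z.2 < fine (lebesgue_measure I)].

(* "Increasing" is taken in the wide sense; for functions in [B_class] it is
   equivalent to strict monotonicity.  Only the values on [0, +oo[ matter. *)
Record young Phi : Prop := Young {
  young_ge0 : forall t, 0 <= t -> 0 <= Phi t;
  young_continuous : {within `[0, +oo[, continuous Phi};
  young_convex : convex_function (`[0, +oo[%classic : set R) Phi;
  young_increasing : {in `[0, +oo[ &, {homo Phi : s t / s <= t}};
  young0 : Phi 0 = 0;
  young_cvgy : Phi t @[t --> +oo] --> +oo;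
  young1 : Phi 1 = 1
}.

Definition Delta2 Phi : Prop :=
  exists2 K : R, 1 < K & forall t, 0 <= t -> Phi (2 * t) <= K * Phi t.

Definition B_class p Phi : Prop :=
  [/\ young Phi, Delta2 Phi &
    exists2 c : R, 0 < c &
      (\int[lebesgue_measure]_(t in `[c, +oo[)
         (Phi t / t `^ p / t)%:E < +oo)%E].

Definition lux_norm Phi alpha I (f : plane R -> R[i]) : \bar R :=
  ereal_inf [set l%:E | l in [set l : R | 0 < l /\
    (intV alpha (carleson I) (fun z => (Phi (modulus (f z) / l))%:E)
       / V alpha (carleson I) <= 1)%E]].

Definition orlicz_maximal Phi alpha (f : plane R -> R[i]) (z : plane R)
    : \bar R :=
  ereal_sup [set lux_norm Phi alpha I f |
    I in [set I | nondeg_interval I /\ carleson I z]].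

Definition maximal alpha (w : plane R -> R) (z : plane R) : \bar R :=
  ereal_sup [set ((\1_(carleson I) z)%:E / V alpha (carleson I)
                    * Vw w alpha (carleson I))%E |
    I in nondeg_interval].

End HalfPlane.

(* Main.v *)
Require Import Defs.
From mathcomp Require Import all_boot all_order all_algebra.
From mathcomp Require Import all_classical all_reals all_analysis.
From mathcomp Require Import measurable_realfun complex zify ring lra.

(** The level set of the Orlicz maximal function above t is covered by Carleson
    squares Q with [V Q <= C \int_Q Phi(|f|/t) 1_{|f| > t/2} dV]; only balls with
    rational centre and radius are needed, so finitely many of them exhaust the
    level set in the limit.  Vitali's finite covering lemma extracts disjoint
    balls B_j whose triples still cover.  Since [\int_{Q(3 B_j)} w dV] is
    [V(Q(3 B_j))] times an average that is at most M w throughout Q(B_j), the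
    hypothesis on mu and the superadditivity of x |-> x^{q/p} give
      mu(M f > t) <= C (\int Phi(|f|/t) 1_{|f| > t/2} M w dV)^{q/p}.
    Multiply by t^q and sum over dyadic t: superadditivity moves the sum inside
    the power, and the B_p condition bounds
    [\sum_t t^p Phi(s/t) 1_{s > t/2}] by [C s^p].

    The maximal functions, suprema over uncountable families, are never shown to
    be measurable: they are compared with measurable countable constructions,
    using that the integral of a nonnegative function is a supremum over simple
    functions and thus monotone without measurability. *)

Set Implicit Arguments.
Unset Strict Implicit.
Unset Printing Implicit Defensive.

Import Order.TTheory GRing.Theory Num.Theory.
Import numFieldNormedType.Exports.

Local Open Scope classical_set_scope.
Local Open Scope ring_scope.

(** * Monotonicity of integrals of nonnegative functions *)

Section NonnegIntegral.
Context d (T : measurableType d) (R : realType).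
Local Open Scope ereal_scope.

Lemma ge0_le_integral_nomeas (mu : {measure set T -> \bar R}) (D : set T)
    (f g : T -> \bar R) :
  (forall x, D x -> 0 <= f x) -> (forall x, D x -> f x <= g x) ->
  \int[mu]_(x in D) f x <= \int[mu]_(x in D) g x.
Proof.
move=> f0 fg.
rewrite !ge0_integralE//; last first.
  by move=> x Dx; apply: le_trans (fg _ Dx); exact: f0.
apply: le_ereal_sup => _ [h hf <-]; exists h => // x.
apply: (le_trans (hf x)); rewrite /patch; case: ifPn => // xD.
by apply: fg; exact: set_mem.
Qed.

End NonnegIntegral.

(** * Superadditivity of powers with exponent at least 1 *)

Section PowerSums.
Context {R : realType}.

(** Split off one factor: x^r = x x^{r-1} <= x (x+y)^{r-1}, and likewise for y; the two bounds add
    up to (x+y)^r. *)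
Lemma powRD_ge (r x y : R) : 1 <= r -> 0 <= x -> 0 <= y ->
  x `^ r + y `^ r <= (x + y) `^ r.
Proof.
move=> r1 x0 y0.
have key (a b : R) : 0 <= a -> a <= b -> a `^ r <= a * b `^ (r - 1).
  rewrite le_eqVlt => /predU1P[<- _|a0 ab].
    by rewrite mul0r powR0// gt_eqF// (lt_le_trans ltr01).
  rewrite -(@mulr_powRB1 _ a r) ?(ltW a0) ?(lt_le_trans ltr01 r1)//.
  by rewrite ler_pM2l// ge0_ler_powR ?nnegrE ?subr_ge0// ltW// (lt_le_trans a0).
rewrite -(@mulr_powRB1 _ (x + y) r) ?addr_ge0//; last exact: lt_le_trans r1.
rewrite mulrDl.
by apply: lerD; apply: key => //; rewrite ?lerDl ?lerDr.
Qed.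

Lemma poweRD_ge (r : R) (x y : \bar R) : 1 <= r -> (0 <= x -> 0 <= y ->
  x `^ r + y `^ r <= (x + y) `^ r)%E.
Proof.
move=> r1 x0 y0; have r0 : r != 0 by rewrite gt_eqF// (lt_le_trans ltr01).
move: x y x0 y0 => [x| |] [y| |] // x0 y0.
- by rewrite -EFinD !poweR_EFin lee_fin powRD_ge.
- by rewrite addey// poweRyr// leey.
- by rewrite addye// poweRyr// leey.
- by rewrite poweRyr// leey.
Qed.

(** Serves twice: for the sum over disjoint balls and for the sum over dyadic levels. *)
Lemma sum_poweR_le (I : Type) (s : seq I) (r : R) (x : I -> \bar R) :
  1 <= r -> (forall i, (0 <= x i)%E) ->
  (\sum_(i <- s) x i `^ r <= (\sum_(i <- s) x i) `^ r)%E.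
Proof.
move=> r1 x0; elim: s => [|i s IH]; first by rewrite !big_nil poweR_ge0.
rewrite !big_cons; apply: le_trans (poweRD_ge r1 _ _) => //.
  by rewrite leeD2l.
by rewrite sume_ge0.
Qed.

Lemma le_poweR (r : R) (x y : \bar R) : 0 <= r -> (0 <= x -> x <= y ->
  x `^ r <= y `^ r)%E.
Proof.
move=> r0 x0 xy; apply: gt0_ler_poweR => //; rewrite in_itv/= leey andbT//.
exact: le_trans xy.
Qed.

End PowerSums.

(** * Integrals of powers on intervals ending at zero *)

Lemma integral_powR_itv_oc {R : realType} (a h : R) : -1 < a -> 0 < h ->
  (\int[lebesgue_measure]_(y in `]0%R, h]) (y `^ a)%:E
   = (h `^ (a + 1) / (a + 1))%:E)%E.
Proof.
move=> a1 h0; have a10 : 0 < a + 1 by lra.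
(* For negative [a] the integrand blows up at 0, so the fundamental theorem of calculus is applied
   on [[e n, h]] and [n] tends to infinity. The shift to [n.+2] keeps [e n] strictly below [h]
   already for [n = 0]. *)
pose e n : R := h / n.+2%:R.
have e0 n : 0 < e n by rewrite divr_gt0.
have eh n : e n < h by rewrite ltr_pdivrMr// ltr_pMr// ltr1n.
pose F (y : R) := y `^ (a + 1) / (a + 1).
have int_e n : (\int[lebesgue_measure]_(y in `[e n, h]) (y `^ a)%:E
    = (F h)%:E - (F (e n))%:E)%E.
  have dF (y : R) : 0 < y -> is_derive y 1 F (y `^ a).
    move=> y0.
    have -> : y `^ a = (a + 1)^-1 *: ((a + 1) * y `^ (a + 1 - 1)).
      by rewrite addrK scalerA mulVf ?gt_eqF// scale1r.
    rewrite (_ : F = (a + 1)^-1 \*: (fun z : R => z `^ (a + 1))).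
      by apply: is_deriveZ; exact: is_derive1_powR.
    by apply/funext => z; rewrite /F /= mulrC.
  have cont (G : R -> R) (g : R -> R) :
      (forall y : R, 0 < y -> is_derive y 1 G (g y)) ->
      forall y : R, 0 < y -> {for y, continuous G}.
    move=> dG y y0; apply/differentiable_continuous/derivable1_diffP.
    by have [] := dG y y0.
  apply: continuous_FTC2 => //.
  - apply: continuous_in_subspaceT => y; rewrite inE/= in_itv/= => /andP[ey _].
    apply: (cont _ _ (is_derive1_powR a)); exact: lt_le_trans ey.
  - split.
    + move=> y; rewrite in_itv/= => /andP[ey _].
      by have [] := dF y (lt_trans (e0 n) ey).
    + apply: cvg_at_right_filter; exact: (cont _ _ dF).
    + apply: cvg_at_left_filter; exact: (cont _ _ dF).
  - move=> y; rewrite in_itv/= => /andP[ey _].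
    by rewrite derive1E; have [_ ->] := dF y (lt_trans (e0 n) ey).
have e_cvg : e n @[n --> \oo] --> 0.
  rewrite -[X in _ --> X](mulr0 h).
  apply: cvgM; first exact: cvg_cst.
  have : (fun n => (@harmonic R) n.+1) @ \oo --> (0 : R).
    by rewrite (@cvg_shiftS R (@harmonic R)); exact: cvg_harmonic.
  exact.
have -> : `]0%R, h]%classic = \bigcup_n `[e n, h]%classic.
  apply/seteqP; split => y /=; rewrite in_itv/=.
    move=> /andP[y0 yh]; have [n _ /(_ n (leqnn n))] :
      \forall n \near \oo, e n < y.
      by apply: (cvgr_lt 0 e_cvg).
    by move=> /= ny; exists n => //=; rewrite in_itv/= yh (ltW ny).
  by move=> [n _] /=; rewrite in_itv/= => /andP[ey ->]; rewrite (lt_le_trans (e0 n)).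
pose u n := (\int[lebesgue_measure]_(y in `[e n, h]) (y `^ a)%:E)%E.
have u_int : u n @[n --> \oo] -->
    (\int[lebesgue_measure]_(y in \bigcup_n `[e n, h]%classic) (y `^ a)%:E)%E.
  apply: ge0_nondecreasing_set_cvg_integral => //.
  + move=> m n mn; apply/subsetPset => y /=; rewrite !in_itv/=.
    move=> /andP[+ ->]; rewrite andbT; apply: le_trans.
    by rewrite ler_pM2l// lef_pV2 ?posrE// ler_nat.
  + move=> n; apply/measurable_EFinP.
    exact: measurable_funS (measurable_powR a).
  + by move=> n y _; rewrite lee_fin powR_ge0.
have u_F : u n @[n --> \oo] --> (F h)%:E.
  rewrite /u; under eq_fun do rewrite int_e -EFinB.
  apply: cvg_EFin; first by near=> n.
  rewrite -[X in _ --> X]subr0; apply: cvgB; first exact: cvg_cst.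
  rewrite -[X in _ --> X](mul0r (a + 1)^-1).
  apply: cvgM; last exact: cvg_cst.
  have /cvg_at_rightP := powR_cvg0 a10; apply; split => //.
by rewrite -(cvg_lim _ u_int)// (cvg_lim _ u_F).
Unshelve. all: by end_near. Qed.

Lemma integral_powR_itv_oo {R : realType} (a h : R) : -1 < a -> 0 < h ->
  (\int[lebesgue_measure]_(y in `]0%R, h[) (y `^ a)%:E
   = (h `^ (a + 1) / (a + 1))%:E)%E.
Proof.
move=> a1 h0; rewrite integral_itv_bndo_bndc ?integral_powR_itv_oc//.
by apply/measurable_EFinP; exact: measurable_funS (measurable_powR a).
Qed.

(** * Carleson squares and their weighted volume *)

Section CarlesonSquares.
Context {R : realType}.
Implicit Types (I : set R) (x r alpha : R).

Lemma carlesonE I :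
  carleson I = I `*` `]0, fine (lebesgue_measure I)[%classic.
Proof. by apply/seteqP; split=> -[x y] /=; rewrite in_itv. Qed.

Lemma measurable_carleson I : nondeg_interval I -> measurable (carleson I).
Proof.
move=> [iI _ _]; rewrite carlesonE; apply: measurableX => //.
exact: is_interval_measurable.
Qed.

Lemma carleson_sub_upper_half I : carleson I `<=` upper_half.
Proof. by move=> z [_ /andP[]]. Qed.

Lemma measurable_upper_half : measurable (@upper_half R).
Proof.
rewrite (_ : upper_half = setT `*` `]0, +oo[%classic); last first.
  by apply/seteqP; split=> -[x y] /=; rewrite in_itv/= andbT// => -[].
by apply: measurableX.
Qed.

Lemma le_lebesgue_measure I J : is_interval I -> is_interval J ->
  I `<=` J -> (lebesgue_measure I <= lebesgue_measure J)%E.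
Proof.
by move=> iI iJ IJ; apply: le_measure => //; rewrite inE;
  exact: is_interval_measurable.
Qed.

Lemma nondeg_interval_measureE I : nondeg_interval I ->
  (lebesgue_measure I = (fine (lebesgue_measure I))%:E)%E.
Proof.
move=> [iI [M [_ bI]] I0]; rewrite fineK// ge0_fin_numE//.
(* [bounded_set] provides a bound by every number strictly above [M], hence the choice of
   [M + 1]. *)
apply: (@le_lt_trans _ _ (lebesgue_measure `[- (M + 1), M + 1]%classic)).
  apply: le_lebesgue_measure => //; first exact: interval_is_interval.
  have M1 : M < M + 1 by rewrite ltrDl.
  by move=> x /(bI _ M1); rewrite /= in_itv/= -ler_norml.
by rewrite lebesgue_measure_itv; case: ifP; rewrite ?ltry.
Qed.

Lemma nondeg_interval_gt0 I : nondeg_interval I ->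
  0 < fine (lebesgue_measure I).
Proof.
by move=> nI; rewrite -lte_fin -nondeg_interval_measureE//; case: nI.
Qed.

Lemma subset_carleson I J : nondeg_interval I -> nondeg_interval J ->
  I `<=` J -> carleson I `<=` carleson J.
Proof.
move=> nI nJ IJ z [zI /andP[z0 zL]]; split; first exact: IJ.
rewrite z0/=; apply: lt_le_trans zL _.
rewrite -lee_fin -!nondeg_interval_measureE//.
by apply: le_lebesgue_measure => //; [case: nI|case: nJ].
Qed.

(** The segment between the two points lies in [I], and its length is their distance. *)
Lemma nondeg_interval_dist I x y : nondeg_interval I -> I x -> I y ->
  `|x - y| <= fine (lebesgue_measure I).
Proof.
move=> nI; wlog : x y / x <= y.
  move=> H Ix Iy; have [xy|/ltW yx] := leP x y; first exact: H.
  by rewrite distrC; exact: H.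
move=> xy Ix Iy; have [iI _ _] := nI.
rewrite distrC ger0_norm ?subr_ge0// -lee_fin -nondeg_interval_measureE//.
have <- : lebesgue_measure `[x, y]%classic = (y - x)%:E.
  rewrite lebesgue_measure_itv/= lte_fin; move: xy; rewrite le_eqVlt.
  by case/predU1P => [->|->//]; rewrite ltxx subrr.
apply: le_lebesgue_measure => //; first exact: interval_is_interval.
by move=> z /=; rewrite in_itv/= => xzy; exact: (iI x y).
Qed.

Lemma nondeg_ball x r : 0 < r -> nondeg_interval (ball x r).
Proof.
move=> r0; split.
- by rewrite ball_itv; exact: interval_is_interval.
- exists (`|x| + r); split; first exact: num_real.
  move=> M xrM y /= xy; apply/ltW/(lt_trans _ xrM).
  by rewrite -ltrBlDl; apply: le_lt_trans xy; rewrite distrC lerB_dist.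
- by rewrite lebesgue_measure_ball ?(ltW r0)// lte_fin pmulrn_lgt0.
Qed.

Lemma fine_measure_ball x r : 0 < r ->
  fine (lebesgue_measure (ball x r)) = 2 * r.
Proof. by move=> r0; rewrite lebesgue_measure_ball ?(ltW r0)//= mulr_natl. Qed.

(** The weighted volume of a Carleson square over an interval of length [L]: the base times the
    integral of y^alpha for y from 0 to [L]. *)
Definition vol alpha (L : R) : R := L * (L `^ (alpha + 1) / (alpha + 1)).

Lemma vol_gt0 alpha L : -1 < alpha -> 0 < L -> 0 < vol alpha L.
Proof.
move=> a1 L0; have a10 : 0 < alpha + 1 by lra.
by rewrite mulr_gt0// divr_gt0// powR_gt0.
Qed.

(** Homogeneity of degree [alpha + 2]; with [k] equal to 3 and 6 it is the source of the geometric
    constants below. *)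
Lemma volM alpha k L : 0 <= k -> 0 <= L ->
  vol alpha (k * L) = k * k `^ (alpha + 1) * vol alpha L.
Proof. by move=> k0 L0; rewrite /vol powRM//; ring. Qed.

Lemma le_vol alpha L M : -1 < alpha -> 0 <= L -> L <= M ->
  vol alpha L <= vol alpha M.
Proof.
move=> a1 L0 LM; have a10 : 0 <= alpha + 1 by lra.
apply: ler_pM => //; first by rewrite divr_ge0// powR_ge0.
rewrite ler_wpM2r ?invr_ge0// ge0_ler_powR ?nnegrE//.
exact: le_trans LM.
Qed.

Lemma measurable_powR_snd alpha (D : set (plane R)) :
  measurable_fun D (fun z : plane R => (z.2 `^ alpha)%:E).
Proof.
apply: measurable_funTS.
apply/measurable_EFinP/(measurableT_comp (measurable_powR alpha)).
exact: measurable_snd.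
Qed.

(** Tonelli: the vertical section over a point of [I] contributes the integral of y^alpha up to the
    side length, and the section over any other point contributes zero. *)
Lemma V_carleson alpha I : -1 < alpha -> nondeg_interval I ->
  V alpha (carleson I) = (vol alpha (fine (lebesgue_measure I)))%:E.
Proof.
move=> a1 nI; have mQ := measurable_carleson nI.
set L := fine _; have L0 : 0 < L := nondeg_interval_gt0 nI.
have mI : measurable I by case: nI => iI _ _; exact: is_interval_measurable.
rewrite /V /intV; under eq_integral do rewrite mul1e.
rewrite integral_mkcond fubini_tonelli1; last 2 first.
- by apply/(measurable_restrictT _ mQ); exact: measurable_powR_snd.
- by apply: erestrict_ge0 => z _; rewrite lee_fin powR_ge0.
set c := L `^ (alpha + 1) / (alpha + 1).
have c0 : 0 <= c by rewrite divr_ge0 ?powR_ge0//; lra.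
transitivity (\int[lebesgue_measure]_x (c%:E * (\1_I x)%:E))%E; last first.
  rewrite ge0_integralZl//; last exact/measurable_EFinP.
  rewrite integral_indic// setIT.
  rewrite /vol -/c [L * c]mulrC [RHS]EFinM; congr (_ * _)%E.
  exact: nondeg_interval_measureE.
apply: eq_integral => x _; rewrite /fubini_F.
have [xI|xI] := boolP (x \in I); last first.
  rewrite indicE (negbTE xI) mule0; apply: integral0_eq => y _.
  rewrite patchE memNset// => -[/= Ix _].
  by rewrite mem_set in xI.
rewrite indicE xI mule1 -integral_powR_itv_oo// [RHS]integral_mkcond.
apply: eq_integral => y _; rewrite !patchE; congr (if _ then _ else _).
apply/idP/idP; rewrite !inE /= in_itv/=; first by case.
by split => //; exact: set_mem.
Qed.

End CarlesonSquares.

(** * Young functions cut off at 1/2 *)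

Section YoungFunctions.
Context {R : realType}.
Variable Phi : R -> R.
Hypothesis hY : young Phi.

(** Evaluated at |f|/t, this keeps only the points where |f| > t/2. Below the cut-off [Phi] is at
    most 1/2, which half of an average equal to 1 can absorb. *)
Definition Phi_tail : R -> R := Phi \_ `]2^-1, +oo[.

Lemma Phi_tailE (u : R) : Phi_tail u = if 2^-1 < u then Phi u else 0.
Proof.
rewrite /Phi_tail patchE; congr (if _ then _ else _).
by apply/idP/idP; rewrite inE/= in_itv/= andbT.
Qed.

Lemma Phi_tail_ge0 (u : R) : 0 <= Phi_tail u.
Proof.
rewrite Phi_tailE; case: ifP => // hu; apply: (young_ge0 hY).
by rewrite ltW// (lt_trans _ hu).
Qed.

Lemma measurable_Phi (D : set R) : measurable D -> D `<=` `[0, +oo[%classic ->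
  measurable_fun D Phi.
Proof.
move=> mD D0; apply: measurable_funS D0 _ => //.
exact: subspace_continuous_measurable_fun (young_continuous hY).
Qed.

Lemma measurable_Phi_tail : measurable_fun setT Phi_tail.
Proof.
apply/(measurable_restrictT _ _).1 => //; apply: measurable_Phi => //.
move=> x /=; rewrite !in_itv/= !andbT => hx.
by rewrite ltW// (lt_trans _ hx).
Qed.

(** Convexity between 0 and 1, where [Phi] takes the values 0 and 1. *)
Lemma Phi_half : Phi 2^-1 <= 2^-1.
Proof.
have := young_convex hY.
have h01 : 0 <= (2^-1 : R) <= 1 by lra.
move=> /(_ (Itv01 (proj1 (andP h01)) (proj2 (andP h01))) 1 0).
rewrite !inE/= !in_itv/= !andbT => /(_ ler01 (lexx _)) H.
have : Phi (2^-1 * 1 + (1 - 2^-1) * 0) <=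
       2^-1 * Phi 1 + (1 - 2^-1) * Phi 0 by exact: H.
by rewrite (young0 hY) (young1 hY) !mulr0 !addr0 !mulr1.
Qed.

Lemma Phi_le_tail (u : R) : 0 <= u -> Phi u <= 2^-1 + Phi_tail u.
Proof.
move=> u0; rewrite Phi_tailE; case: ltP => hu; first by lra.
rewrite addr0; apply: le_trans Phi_half.
by apply: (young_increasing hY); rewrite ?in_itv/= ?andbT.
Qed.

End YoungFunctions.

(** * From the integral condition B_p to dyadic sums *)

Section BpCondition.
Context {R : realType}.
Variables (p : R) (Phi : R -> R).
Hypotheses (p0 : 0 <= p) (hB : B_class p Phi).

Let hY : young Phi. Proof. by case: hB. Qed.

Let g (t : R) : R := Phi t / t `^ p / t.

Let g_ge0 (t : R) : 0 <= t -> 0 <= g t.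
Proof.
by move=> t0; rewrite divr_ge0// divr_ge0 ?powR_ge0//; exact: (young_ge0 hY).
Qed.

Let measurable_g (D : set R) : measurable D -> D `<=` `]0, +oo[%classic ->
  measurable_fun D (EFin \o g).
Proof.
move=> mD D0; apply/measurable_EFinP.
have D0' : D `<=` `[0, +oo[%classic.
  by move=> x /D0 /=; rewrite !in_itv/= !andbT => /ltW.
apply: (eq_measurable_fun (fun t => Phi t * t `^ (- p) * t `^ (- 1))).
  move=> t; rewrite inE => /D0 /=; rewrite in_itv/= andbT => t0.
  by rewrite !powRN powRr1 ?(ltW t0).
apply: measurable_funM; last exact: measurable_funTS (measurable_powR _).
apply: measurable_funM; last exact: measurable_funTS (measurable_powR _).
exact: measurable_Phi.
Qed.

Let half_gt0 : 0 < (2^-1 : R). Proof. by rewrite invr_gt0. Qed.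

(* The integrand is monotone up to a factor 2^{p+1} on the dyadic interval
   [a, 2a[, so that its integral there dominates its value at the left end. *)
Let dyadic_block (a : R) : 0 < a ->
  ((Phi a / a `^ p)%:E <=
   (2 `^ p * 2)%:E * \int[lebesgue_measure]_(t in `[a, (2 * a)%R[) (g t)%:E)%E.
Proof.
move=> a0; have a2 : a < 2 * a by lra.
have sub : `[a, (2 * a)[%classic `<=` `]0, +oo[%classic.
  move=> t /=; rewrite !in_itv/= andbT => /andP[+ _]; exact: lt_le_trans.
(* A lower bound of [g] on the block: numerator at the left end, denominators at the right end. Its
   integral over the block, of length [a], is the left-hand side divided by the constant. *)
pose m : R := Phi a / (2 * a) `^ p / (2 * a).
have m0 : 0 <= m.
  by rewrite divr_ge0 ?divr_ge0 ?powR_ge0 ?(young_ge0 hY)//; lra.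
have -> : (Phi a / a `^ p)%:E =
    ((2 `^ p * 2)%:E * \int[lebesgue_measure]_(t in `[a, (2 * a)%R[) m%:E)%E.
  rewrite integral_cst//= lebesgue_measure_itv/= lte_fin a2 -EFinB -!EFinM.
  congr EFin; rewrite /m powRM ?(ltW a0)//.
  by field; rewrite !gt_eqF ?powR_gt0.
rewrite lee_wpmul2l ?lee_fin ?mulr_ge0 ?powR_ge0//.
apply: ge0_le_integral => //.
- exact: measurable_g.
move=> t /=; rewrite in_itv/= => /andP[at_ ta]; rewrite lee_fin.
have t0 : 0 < t := lt_le_trans a0 at_.
have Pat : Phi a <= Phi t.
  by apply: (young_increasing hY); rewrite ?in_itv/= ?andbT// ltW.
apply: ler_pM.
- by rewrite divr_ge0 ?powR_ge0 ?(young_ge0 hY)// ltW.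
- by rewrite invr_ge0; lra.
- apply: ler_pM => //.
  + by rewrite (young_ge0 hY)// ltW.
  + by rewrite invr_ge0 powR_ge0.
  + rewrite lef_pV2 ?posrE ?powR_gt0//; last by lra.
    by rewrite ge0_ler_powR// ?nnegrE; lra.
- by rewrite lef_pV2 ?posrE//; lra.
Qed.

Let tail_integral := (\int[lebesgue_measure]_(t in `[2^-1%R, +oo[) (g t)%:E)%E.

(** The B_p condition gives convergence only from some [c] on. Between 1/2 and the larger of 1/2 and
    [c] the integrand is bounded, with numerator at most its value at the right end and denominators
    at least their values at 1/2. *)
Let tail_integral_fin : (tail_integral < +oo)%E.
Proof.
have [_ _ [c c0 hc]] := hB.
pose m := Num.max 2^-1 c.
have hm : 2^-1 <= m by rewrite le_max lexx.
have cm : c <= m by rewrite le_max lexx orbT.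
have m0 : 0 < m := lt_le_trans half_gt0 hm.
have sub0 (x : R) : 0 < x -> `[x, +oo[%classic `<=` `]0, +oo[%classic.
  by move=> x0 t /=; rewrite !in_itv/= !andbT; exact: lt_le_trans.
have sub1 : `[2^-1, m[%classic `<=` `[2^-1, +oo[%classic.
  by move=> t /=; rewrite !in_itv/= andbT => /andP[].
rewrite /tail_integral.
rewrite (@itv_bndbnd_setU _ _ (BLeft 2^-1) (BLeft m) +oo%O)//.
rewrite ge0_integral_setU//=; first last.
- apply/disj_setPS => t [/=]; rewrite !in_itv/= andbT => /andP[_ tm] mt.
  by move: (lt_le_trans tm mt); rewrite ltxx.
- move=> t; rewrite !in_itv/= andbT => -[/andP[ht _]|ht];
  by rewrite lee_fin g_ge0// ltW//; lra.
- apply: measurable_g; first exact: measurableU.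
  move=> t [/sub1|]; [exact: sub0|exact: sub0].
apply: lte_add_pinfty.
- pose M := Phi m / 2^-1 `^ p / 2^-1.
  apply: (@le_lt_trans _ _ (\int[lebesgue_measure]_(t in `[2^-1%R, m[) M%:E)%E).
    apply: ge0_le_integral => //.
    + move=> t /=; rewrite in_itv/= => /andP[ht _]; rewrite lee_fin g_ge0//.
      by rewrite ltW// (lt_le_trans _ ht).
    + by apply: measurable_g => //; exact: subset_trans sub1 (sub0 _ half_gt0).
    move=> t /=; rewrite in_itv/= => /andP[ht tm]; rewrite lee_fin.
    have t0 : 0 < t := lt_le_trans half_gt0 ht.
    have Ptm : Phi t <= Phi m.
      by apply: (young_increasing hY); rewrite ?in_itv/= ?andbT// ltW.
    apply: ler_pM.
    - by rewrite divr_ge0 ?powR_ge0 ?(young_ge0 hY)// ltW.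
    - by rewrite invr_ge0 ltW.
    - apply: ler_pM => //.
      + by rewrite (young_ge0 hY)// ltW.
      + by rewrite invr_ge0 powR_ge0.
      + rewrite lef_pV2 ?posrE ?powR_gt0//.
        by rewrite ge0_ler_powR ?nnegrE// ltW.
    - by rewrite lef_pV2 ?posrE.
  rewrite integral_cst//= lebesgue_measure_itv/= lte_fin.
  by case: ifP; rewrite ?mule0 ?ltry.
- apply: le_lt_trans hc; apply: ge0_subset_integral => //.
  + by apply: measurable_g => //; exact: sub0.
  + move=> t /=; rewrite in_itv/= andbT => ct; rewrite lee_fin g_ge0//.
    by rewrite ltW// (lt_le_trans c0).
  + by move=> t /=; rewrite !in_itv/= !andbT; exact: le_trans.
Qed.

Let F (x : R) :=
  (\int[lebesgue_measure]_(t in `[(Num.max 2^-1 x)%R, +oo[) (g t)%:E)%E.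

(** The points [b / 2 ^+ i] descend and the blocks of [dyadic_block] starting there are adjacent, so
    each term extends the integral to the left by one block. The argument [2 * (b / 2 ^+ n)] is the
    right end of the block to be added next. Terms at points not above 1/2 vanish, whence the
    cut-off at 1/2 in [F]. *)
Let dyadic_sum (b : R) (n : nat) : 0 < b ->
  ((\sum_(i < n) Phi_tail Phi (b / 2 ^+ i) / (b / 2 ^+ i) `^ p)%:E
   <= (2 `^ p * 2)%:E * F (2 * (b / 2 ^+ n)))%E.
Proof.
move=> b0; have K0 : (0 <= (2 `^ p * 2 : R)%:E)%E.
  by rewrite lee_fin mulr_ge0 ?powR_ge0.
have sub (x : R) : `[Num.max 2^-1 x, +oo[%classic `<=` `]0, +oo[%classic.
  move=> t /=; rewrite !in_itv/= !andbT ge_max => /andP[ht _].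
  exact: lt_le_trans ht.
have mF (x : R) : measurable_fun `[Num.max 2^-1 x, +oo[ (EFin \o g).
  exact: measurable_g.
have pF (x t : R) : `[Num.max 2^-1 x, +oo[%classic t -> (0 <= (g t)%:E)%E.
  by move=> /sub /=; rewrite in_itv/= andbT => t0; rewrite lee_fin g_ge0// ltW.
elim: n => [|n IH].
  by rewrite big_ord0 mule_ge0// integral_ge0// => t; exact: pF.
rewrite big_ord_recr/= EFinD.
have -> : 2 * (b / 2 ^+ n.+1) = b / 2 ^+ n.
  by rewrite exprS; field; rewrite expf_neq0.
set a := b / 2 ^+ n in IH *.
have a0 : 0 < a by rewrite divr_gt0// exprn_gt0.
have [ha|ha] := ltP 2^-1 a; last first.
  rewrite {2}/Phi_tail patchE memNset/=; last first.
    by rewrite in_itv/= andbT; apply/negP; rewrite -leNgt.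
  rewrite mul0r adde0; apply: le_trans IH _; apply: lee_wpmul2l => //.
  apply: ge0_subset_integral => //; [exact: mF|move=> t; exact: pF|].
  move=> t /=; rewrite !in_itv/= !andbT !ge_max => /andP[-> /=].
  by apply: le_trans; lra.
rewrite Phi_tailE ha.
apply: le_trans (leeD IH (dyadic_block a0)) _.
rewrite -ge0_muleDr//; last 2 first.
- by apply: integral_ge0 => t; exact: pF.
- apply: integral_ge0 => t /=; rewrite in_itv/= => /andP[at_ _].
  by rewrite lee_fin g_ge0// ltW// (lt_le_trans a0).
rewrite lee_wpmul2l// /F max_r; last by lra.
rewrite max_r ?(ltW ha)//.
rewrite (@itv_bndbnd_setU _ _ (BLeft a) (BLeft (2 * a)) +oo%O)//; last first.
  by rewrite bnd_simp; lra.
rewrite ge0_integral_setU//=.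
- by rewrite addeC.
- apply: measurable_g; first exact: measurableU.
  move=> t [] /=; rewrite !in_itv/= !andbT; first by case/andP => + _; exact: lt_le_trans.
  by apply: lt_le_trans; lra.
- move=> t [] /=; rewrite !in_itv/= ?andbT => ht; rewrite lee_fin g_ge0//.
    by case/andP: ht => ht _; lra.
  by lra.
- apply/disj_setPS => t [/=]; rewrite !in_itv/= andbT => /andP[_ tm] mt.
  by move: (lt_le_trans tm mt); rewrite ltxx.
Qed.

(** With u = s/t, the term t^p Phi(s/t) becomes s^p Phi(u)/u^p, and u runs through the descending
    points of [dyadic_sum] with [b] equal to [s / e]. Since the bound there is at most the full tail
    integral, the constant is uniform in the lowest level [e] and in the number of levels. *)
Lemma B_class_sum : exists2 C : R, 0 < C &
  forall (s e : R) (n : nat), 0 <= s -> 0 < e ->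
  \sum_(i < n) (e * 2 ^+ i) `^ p * Phi_tail Phi (s / (e * 2 ^+ i))
    <= C * s `^ p.
Proof.
have K0 : 0 < (2 `^ p * 2 : R) by rewrite mulr_gt0 ?powR_gt0.
have J0 : (0 <= tail_integral)%E.
  apply: integral_ge0 => t /=; rewrite in_itv/= andbT => ht.
  by rewrite lee_fin g_ge0// ltW// (lt_le_trans _ ht).
have Jfin : tail_integral \is a fin_num by rewrite ge0_fin_numE.
(* The added 1 yields a positive constant from mere nonnegativity of the integral. *)
exists (2 `^ p * 2 * (fine tail_integral + 1)).
  by rewrite mulr_gt0// ltr_wpDl// fine_ge0.
move=> s e n; rewrite le_eqVlt => /predU1P[<- e0|s0 e0].
  rewrite big1; first by rewrite !mulr_ge0 ?powR_ge0// addr_ge0 ?fine_ge0.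
  move=> i _; rewrite mul0r Phi_tailE ltNge invr_ge0 ler0n/=.
  by rewrite mulr0.
have b0 : 0 < s / e by rewrite divr_gt0.
rewrite (eq_bigr (fun i : 'I_n => s `^ p *
    (Phi_tail Phi (s / e / 2 ^+ i) / (s / e / 2 ^+ i) `^ p))); last first.
  move=> i _; have i0 : 0 < (2 ^+ i : R) by rewrite exprn_gt0.
  have -> : s / e / 2 ^+ i = s / (e * 2 ^+ i).
    by field; rewrite !gt_eqF.
  have t0 : 0 < e * 2 ^+ i by rewrite mulr_gt0.
  set t := e * 2 ^+ i in t0 *.
  have st0 : 0 < s / t by rewrite divr_gt0.
  have -> : s `^ p = (s / t) `^ p * t `^ p.
    by rewrite -powRM ?(ltW st0) ?(ltW t0)// divfK// gt_eqF.
  by field; rewrite gt_eqF// powR_gt0.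
rewrite -mulr_sumr mulrC ler_wpM2r ?powR_ge0//.
rewrite -lee_fin; apply: le_trans (dyadic_sum n b0) _.
rewrite [leRHS]EFinM lee_wpmul2l ?lee_fin ?(ltW K0)// EFinD fineK//.
rewrite -[leLHS]adde0; apply: leeD => //.
apply: ge0_subset_integral => //.
- apply: measurable_g => // t /=; rewrite !in_itv/= !andbT.
  exact: lt_le_trans.
- move=> t /=; rewrite in_itv/= andbT => ht.
  by rewrite lee_fin g_ge0// ltW// (lt_le_trans _ ht).
- by move=> t /=; rewrite !in_itv/= !andbT ge_max => /andP[].
Qed.

End BpCondition.

(** * Weighted integrals and the Luxembourg norm *)

Section LuxemburgNorm.
Context {R : realType}.
Implicit Types (alpha t : R) (I : set R) (E : set (plane R)) (f : plane R -> R[i]).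

Lemma modulus_ge0 (u : R[i]) : 0 <= modulus u.
Proof. by case: u => x y; exact: sqrtr_ge0. Qed.

Lemma measurable_modulus E f : measurable_cfun E f ->
  measurable_fun E (fun z => modulus (f z)).
Proof.
move=> [mre mim].
have -> : (fun z => modulus (f z)) =
    Num.sqrt \o (fun z => complex.Re (f z) ^+ 2 + complex.Im (f z) ^+ 2).
  by apply/funext => z /=; case: (f z).
apply: measurableT_comp.
  by apply: continuous_measurable_fun; exact: sqrt_continuous.
by apply: measurable_funD; exact: measurable_funX.
Qed.

Lemma measurable_intV_integrand alpha E (g : plane R -> \bar R) :
  measurable_fun E g -> measurable_fun E (fun z => g z * (z.2 `^ alpha)%:E)%E.
Proof.
by move=> mg; apply: emeasurable_funM => //; exact: measurable_powR_snd.
Qed.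

Lemma intV_ge0 alpha E (g : plane R -> \bar R) :
  (forall z, E z -> 0 <= g z)%E -> (0 <= intV alpha E g)%E.
Proof.
move=> g0; apply: integral_ge0 => z Ez.
by rewrite mule_ge0 ?g0// lee_fin powR_ge0.
Qed.

Lemma le_intV alpha E (g h : plane R -> \bar R) :
  (forall z, E z -> 0 <= g z)%E -> (forall z, E z -> g z <= h z)%E ->
  (intV alpha E g <= intV alpha E h)%E.
Proof.
move=> g0 gh; apply: ge0_le_integral_nomeas => z Ez.
  by rewrite mule_ge0 ?g0// lee_fin powR_ge0.
by rewrite lee_wpmul2r ?gh// lee_fin powR_ge0.
Qed.

(** The factor is allowed to be infinite because it will be an average of the weight over a Carleson
    square, and the weight need not be integrable up to the boundary line. *)
Lemma intVZr alpha E (g : plane R -> \bar R) (k : \bar R) :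
  measurable E -> measurable_fun E g -> (forall z, E z -> 0 <= g z)%E ->
  (0 <= k)%E -> (intV alpha E (fun z => g z * k) = intV alpha E g * k)%E.
Proof.
move=> mE mg g0 k0; rewrite /intV -ge0_integralZr//.
- by apply: eq_integral => z _; rewrite muleAC.
- exact: measurable_intV_integrand.
- by move=> z Ez; rewrite mule_ge0 ?g0// lee_fin powR_ge0.
Qed.

Lemma intVD alpha E (g h : plane R -> \bar R) :
  measurable E -> measurable_fun E g -> (forall z, E z -> 0 <= g z)%E ->
  measurable_fun E h -> (forall z, E z -> 0 <= h z)%E ->
  (intV alpha E (fun z => g z + h z) = intV alpha E g + intV alpha E h)%E.
Proof.
move=> mE mg g0 mh h0; rewrite /intV -ge0_integralD//.
- by apply: eq_integral => z /set_mem Ez; rewrite ge0_muleDl ?g0 ?h0.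
- by move=> z Ez; rewrite mule_ge0 ?g0// lee_fin powR_ge0.
- exact: measurable_intV_integrand.
- by move=> z Ez; rewrite mule_ge0 ?h0// lee_fin powR_ge0.
- exact: measurable_intV_integrand.
Qed.

Lemma measurable_Phi_tail_comp (Phi : R -> R) t E (f : plane R -> R[i]) :
  young Phi -> measurable_cfun E f ->
  measurable_fun E (fun z => (Phi_tail Phi (modulus (f z) / t))%:E).
Proof.
move=> hY mf; apply/measurable_EFinP.
apply: (measurableT_comp (measurable_Phi_tail hY)).
by apply: measurable_funM => //; exact: measurable_modulus.
Qed.

Lemma measurable_cfunS E f : E `<=` upper_half ->
  measurable_cfun upper_half f -> measurable_cfun E f.
Proof.
move=> EH [mre mim]; split.
  exact: measurable_funS measurable_upper_half EH mre.
exact: measurable_funS measurable_upper_half EH mim.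
Qed.

(* Where |f| <= t/2, convexity and [Phi 1 = 1] bound [Phi (|f| / t)] by 1/2, so
   only the part of [f] above t/2 can push the average beyond 1. *)
Lemma lt_lux_norm (Phi : R -> R) alpha t I f :
  -1 < alpha -> young Phi -> nondeg_interval I ->
  measurable_cfun upper_half f -> 0 < t ->
  (t%:E < lux_norm Phi alpha I f)%E ->
  (V alpha (carleson I) <= 2%:E * intV alpha (carleson I)
     (fun z => (Phi_tail Phi (modulus (f z) / t))%:E))%E.
Proof.
move=> a1 hY nI mf t0 tlt.
have mQ := measurable_carleson nI.
have mfQ := measurable_cfunS (@carleson_sub_upper_half _ I) mf.
have vE := V_carleson a1 nI.
set v := vol alpha _ in vE; have v0 : 0 < v := vol_gt0 a1 (nondeg_interval_gt0 nI).
have ht0 z : 0 <= modulus (f z) / t.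
  by rewrite divr_ge0 ?modulus_ge0// ltW.
set T := intV _ _ _.
have : ((intV alpha (carleson I) (fun z => (Phi (modulus (f z) / t))%:E))
     <= (2^-1)%:E * V alpha (carleson I) + T)%E.
  have -> : ((2^-1)%:E * V alpha (carleson I))%E =
      intV alpha (carleson I) (fun=> (2^-1)%:E).
    rewrite muleC /V -intVZr// ?lee_fin ?invr_ge0//.
    by congr intV; apply/funext => z /=; rewrite mul1e.
  rewrite -intVD//.
  - apply: le_intV => z _; first by rewrite lee_fin (young_ge0 hY).
    by rewrite lee_fin Phi_le_tail.
  - exact: measurable_Phi_tail_comp.
  - by move=> z _; rewrite lee_fin Phi_tail_ge0.
(* If the average at [t] were at most 1, then [t] would be one of the numbers whose infimum is the
   norm. *)
have : ~ (intV alpha (carleson I) (fun z => (Phi (modulus (f z) / t))%:E)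
     / V alpha (carleson I) <= 1)%E.
  move=> avg1; move: tlt; apply/negP; rewrite -leNgt.
  by apply: ereal_inf_lbound; exists t.
rewrite vE inver gt_eqF// lee_pdivrMr// mul1e => /negP; rewrite -ltNge.
(* Now v < v/2 + T, that is v < 2T when [T] is finite; an infinite [T] is trivial. *)
move=> lt1 le2; have {lt1 le2} := lt_le_trans lt1 le2.
rewrite -EFinM; case: T => [r| |]//.
- rewrite -EFinD lte_fin -EFinM lee_fin; lra.
- by move=> _; rewrite gt0_muley ?leey// lte_fin.
Qed.

End LuxemburgNorm.

(** * A countable family of balls and its maximal function *)

Section RationalBalls.
Context {R : realType}.
Implicit Types (alpha : R) (I : set R) (w : plane R -> R).

(** Decoding enumerates all pairs of a rational centre and a rational radius. Numbers that code no
    pair get a default, and [rat_radius] replaces nonpositive radii by 1, so that every index yields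
    a genuine ball. *)
Definition rat_ball_code (n : nat) : rat * rat := odflt (0, 1) (unpickle n).

Definition rat_center (n : nat) : R := ratr (rat_ball_code n).1.

Definition rat_radius (n : nat) : R :=
  if 0 < (rat_ball_code n).2 then ratr (rat_ball_code n).2 else 1.

Lemma rat_radius_gt0 n : 0 < rat_radius n.
Proof. by rewrite /rat_radius; case: ifP => // h; rewrite ltr0q. Qed.

Definition rat_ball (n : nat) : set R := ball (rat_center n) (rat_radius n).

Definition rat_ball3 (n : nat) : set R := ball (rat_center n) (3 * rat_radius n).

(** Radius above [2 * L]: the ball contains every interval of length [L] through [x]. Radius below
    [3 * L]: its length stays under [6 * L]. *)
Lemma rat_ball_dense (x L : R) : 0 < L ->
  exists n, `|rat_center n - x| < L /\ 2 * L < rat_radius n < 3 * L.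
Proof.
move=> L0.
have /rat_in_itvoo[c] : x - L < x + L by lra.
rewrite in_itv/= => cx.
have /rat_in_itvoo[r] : 2 * L < 3 * L by lra.
rewrite in_itv/= => hr.
have r0 : 0 < r by rewrite -(ltr0q R); lra.
exists (pickle (c, r)).
rewrite /rat_center /rat_radius /rat_ball_code pickleK/= r0; split => //.
by rewrite ltr_norml; lra.
Qed.

Lemma nondeg_rat_ball n : nondeg_interval (rat_ball n).
Proof. exact: nondeg_ball (rat_radius_gt0 n). Qed.

Lemma nondeg_rat_ball3 n : nondeg_interval (rat_ball3 n).
Proof. by apply: nondeg_ball; rewrite mulr_gt0// rat_radius_gt0. Qed.

Lemma rat_ball_sub3 n : rat_ball n `<=` rat_ball3 n.
Proof. by apply: le_ball; have := rat_radius_gt0 n; lra. Qed.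

Lemma V_rat_ball alpha n : -1 < alpha ->
  V alpha (carleson (rat_ball n)) = (vol alpha (2 * rat_radius n))%:E.
Proof.
move=> a1; rewrite V_carleson//; last exact: nondeg_rat_ball.
by rewrite fine_measure_ball// rat_radius_gt0.
Qed.

Lemma V_rat_ball3 alpha n : -1 < alpha ->
  (V alpha (carleson (rat_ball3 n)) =
   (3 * 3 `^ (alpha + 1))%:E * V alpha (carleson (rat_ball n)))%E.
Proof.
move=> a1; have r0 := rat_radius_gt0 n.
rewrite V_rat_ball// V_carleson//; last exact: nondeg_rat_ball3.
rewrite fine_measure_ball ?mulr_gt0// mulrCA -EFinM volM//.
by rewrite mulr_ge0// ltW.
Qed.

Lemma Vw_ge0 w alpha I : weight w -> (0 <= Vw w alpha (carleson I))%E.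
Proof.
move=> hw; apply: intV_ge0 => z Qz /=; rewrite lee_fin (weight_ge0 hw)//.
exact: carleson_sub_upper_half Qz.
Qed.

(* Unlike [maximal], a countable supremum, hence measurable. *)
Definition rat_maximal alpha w (z : plane R) : \bar R :=
  ereal_sup (range (fun n => (\1_(carleson (rat_ball3 n)) z)%:E
    / V alpha (carleson (rat_ball3 n)) * Vw w alpha (carleson (rat_ball3 n))))%E.

Lemma rat_maximal_le alpha w z : (rat_maximal alpha w z <= maximal alpha w z)%E.
Proof.
apply: le_ereal_sup => _ [n _ <-]; exists (rat_ball3 n) => //.
exact: nondeg_rat_ball3.
Qed.

Lemma le_rat_maximal alpha w z n : carleson (rat_ball3 n) z ->
  ((V alpha (carleson (rat_ball3 n)))^-1 * Vw w alpha (carleson (rat_ball3 n))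
   <= rat_maximal alpha w z)%E.
Proof.
move=> Qz; apply: ereal_sup_ubound; exists n => //=.
by rewrite indicE mem_set// mul1e.
Qed.

Lemma rat_maximal_ge0 alpha w z : weight w ->
  (0 <= rat_maximal alpha w z)%E.
Proof.
move=> hw; apply: le_ereal_sup_tmp; eexists; first by exists 0%N.
by rewrite !mule_ge0 ?Vw_ge0 ?inve_ge0 ?lee_fin// intV_ge0.
Qed.

Lemma measurable_rat_maximal alpha w (E : set (plane R)) :
  measurable_fun E (rat_maximal alpha w).
Proof.
pose u n (z : plane R) := ((\1_(carleson (rat_ball3 n)) z)%:E
    / V alpha (carleson (rat_ball3 n)) * Vw w alpha (carleson (rat_ball3 n)))%E.
have -> : rat_maximal alpha w = (fun z => esups (u ^~ z) 0%N).
  apply/funext => z; rewrite /rat_maximal /esups/= /sdrop/=.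
  by congr ereal_sup; apply/seteqP; split => _ [n _ <-]; exists n.
apply: measurable_fun_esups => n; apply: emeasurable_funM => //.
apply: emeasurable_funM => //.
apply/measurable_EFinP; apply: measurable_indic.
exact: measurable_carleson (nondeg_rat_ball3 n).
Qed.

End RationalBalls.

(** * Vitali covering and the weak-type estimate *)

Lemma measure_bigsetU_le d (T : measurableType d) (R : realType)
    (mu : {measure set T -> \bar R}) (I : Type) (s : seq I) (F : I -> set T) :
  (forall i, measurable (F i)) ->
  (mu (\big[setU/set0]_(i <- s) F i) <= \sum_(i <- s) mu (F i))%E.
Proof.
move=> mF; elim: s => [|i s IH]; first by rewrite !big_nil measure0.
rewrite !big_cons.
apply: (@le_trans _ _ (mu (F i) + mu (\big[setU/set0]_(j <- s) F j))%E).
  by apply: measureU2 => //; exact: bigsetU_measurable.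
exact: leeD2l.
Qed.

Section WeakType.
Context {R : realType}.
Variables (alpha : R) (Phi : R -> R) (w : plane R -> R).
Variable f : plane R -> R[i].
Hypotheses (alpha_gt : -1 < alpha) (hY : young Phi) (hw : weight w).
Hypothesis mf : measurable_cfun upper_half f.

Definition tail_at (t : R) (z : plane R) : \bar R :=
  (Phi_tail Phi (modulus (f z) / t))%:E.

Lemma tail_at_ge0 t z : (0 <= tail_at t z)%E.
Proof. by rewrite lee_fin Phi_tail_ge0. Qed.

Lemma measurable_tail_at t (E : set (plane R)) : measurable E ->
  E `<=` upper_half -> measurable_fun E (tail_at t).
Proof.
by move=> mE EH; apply: measurable_Phi_tail_comp => //; exact: measurable_cfunS.
Qed.

(** Expressed by integrals instead of the norm of [f], the condition passes from an interval to a
    larger ball of comparable length, with a larger [C]. *)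
Definition selected (C t : R) (n : nat) : Prop :=
  (V alpha (carleson (rat_ball n)) <=
   C%:E * intV alpha (carleson (rat_ball n)) (tail_at t))%E.

Definition selected_union (C t : R) (K : nat) : set (plane R) :=
  \bigcup_(n in [set n | (n < K)%N /\ selected C t n]) carleson (rat_ball n).

(** The 2 comes from [lt_lux_norm], the other factor from [volM] when the length grows sixfold. *)
Definition cover_const : R := 2 * (6 * 6 `^ (alpha + 1)).

(** Replacing [I] by a rational ball around it multiplies the volume by at most the second factor of
    [cover_const], while the integral of the tail can only grow. *)
Lemma lux_norm_selected t I z : 0 < t -> nondeg_interval I -> carleson I z ->
  (t%:E < lux_norm Phi alpha I f)%E ->
  exists2 n, carleson (rat_ball n) z & selected cover_const t n.
Proof.
move=> t0 nI Qz tlt.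
have L0 := nondeg_interval_gt0 nI; set L := fine _ in L0.
have [n [cn rn]] := rat_ball_dense z.1 L0.
have In : I `<=` rat_ball n.
  move=> y Iy; rewrite /rat_ball /ball/=.
  have := nondeg_interval_dist nI Qz.1 Iy; rewrite -/L => zy.
  have := ler_distD z.1 (rat_center n) y; lra.
have QQ : carleson I `<=` carleson (rat_ball n).
  exact: subset_carleson (nondeg_rat_ball n) In.
exists n; first exact: QQ.
rewrite /selected /cover_const mulrC; set k : R := 6 * 6 `^ (alpha + 1).
have k0 : 0 <= k by rewrite mulr_ge0 ?powR_ge0.
apply: (@le_trans _ _ (k%:E * V alpha (carleson I))%E).
  rewrite V_rat_ball// V_carleson// -EFinM lee_fin -/L -volM// ?(ltW L0)//.
  by apply: le_vol => //; have := rat_radius_gt0 n (R := R); lra.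
rewrite (EFinM k 2) -muleA; apply: lee_wpmul2l; first by rewrite lee_fin.
apply: le_trans (lt_lux_norm alpha_gt hY nI mf t0 tlt) _.
apply: lee_wpmul2l => //; apply: ge0_subset_integral => //.
- exact: measurable_carleson.
- exact: measurable_carleson (nondeg_rat_ball n).
- apply: measurable_intV_integrand; apply: measurable_tail_at.
    exact: measurable_carleson (nondeg_rat_ball n).
  exact: carleson_sub_upper_half.
- by move=> y _; rewrite mule_ge0 ?tail_at_ge0// lee_fin powR_ge0.
Qed.

(** The mass is the volume of the tripled square times the average [a] of the weight. Selection
    trades the volume of the small square for an integral of the tail over it, and there [a] is at
    most [rat_maximal], the small square being part of the tripled one. *)
Lemma Vw_ball3_le C t n : 0 <= C -> selected C t n ->
  (Vw w alpha (carleson (rat_ball3 n)) <=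
   (3 * 3 `^ (alpha + 1) * C)%:E *
   intV alpha (carleson (rat_ball n))
     (fun z => tail_at t z * rat_maximal alpha w z))%E.
Proof.
move=> C0 sel; set A := Vw _ _ _.
have A0 : (0 <= A)%E by exact: Vw_ge0.
set k : R := 3 * 3 `^ (alpha + 1).
have k0 : 0 < k by rewrite mulr_gt0// powR_gt0.
have V3 := V_rat_ball3 n alpha_gt; rewrite -/k in V3.
have V1 := V_rat_ball n alpha_gt.
set v := vol _ _ in V1.
have v0 : 0 < v by rewrite vol_gt0// mulr_gt0// rat_radius_gt0.
have kv0 : 0 < k * v by rewrite mulr_gt0.
have V3E : V alpha (carleson (rat_ball3 n)) = (k * v)%:E.
  by rewrite V3 V1.
pose a := ((V alpha (carleson (rat_ball3 n)))^-1 * A)%E.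
have a0 : (0 <= a)%E.
  by rewrite mule_ge0// inve_ge0 V3E lee_fin ltW.
have mQ : measurable (carleson (rat_ball n : set R)).
  exact: measurable_carleson (nondeg_rat_ball n).
have mtail : measurable_fun (carleson (rat_ball n)) (tail_at t).
  by apply: measurable_tail_at => //; exact: carleson_sub_upper_half.
have AE : A = ((k * v)%:E * a)%E.
  rewrite /a V3E inver gt_eqF// muleA -EFinM mulfV ?mul1e// gt_eqF//.
apply: (@le_trans _ _ ((k * C)%:E *
    intV alpha (carleson (rat_ball n)) (fun z => tail_at t z * a))%E).
  rewrite intVZr//; last by move=> z _; exact: tail_at_ge0.
  rewrite AE [leRHS]muleA; apply: lee_wpmul2r => //.
  rewrite (EFinM k v) (EFinM k C) -muleA.
  apply: lee_wpmul2l; first by rewrite lee_fin ltW.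
  by rewrite -V1.
apply: lee_wpmul2l; first by rewrite lee_fin mulr_ge0// ltW.
apply: le_intV => z Qz; first by rewrite mule_ge0 ?tail_at_ge0.
apply: lee_wpmul2l; first exact: tail_at_ge0.
apply: le_rat_maximal.
apply: subset_carleson Qz; [exact: nondeg_rat_ball|exact: nondeg_rat_ball3|].
exact: rat_ball_sub3.
Qed.

Lemma measurable_selected_union C t K : measurable (selected_union C t K).
Proof.
apply: bigcup_measurable => n _; exact: measurable_carleson (nondeg_rat_ball n).
Qed.

Lemma selected_union_sub C t K : selected_union C t K `<=` upper_half.
Proof. by move=> z [n _]; exact: carleson_sub_upper_half. Qed.

Lemma weak_type (mu : {measure set (plane R) -> \bar R}) (C1 C r t : R) (K : nat) :
  0 <= C1 -> 0 <= C -> 1 <= r ->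
  (forall I : set R, nondeg_interval I ->
    mu (carleson I) <= C1%:E * Vw w alpha (carleson I) `^ r)%E ->
  (mu (selected_union C t K) <= C1%:E *
    ((3 * 3 `^ (alpha + 1) * C)%:E *
     intV alpha upper_half (fun z => tail_at t z * rat_maximal alpha w z)) `^ r)%E.
Proof.
move=> C10 C0 r1 hmu.
pose s := [seq n <- iota 0 K | `[< selected C t n >]].
have ball_n n : is_ball (rat_ball n : set R) by exact: is_ball_ball.
have ball_n0 n : (rat_ball n : set R) !=set0.
  by exists (rat_center n); apply: ballxx; exact: rat_radius_gt0.
(* Covering the union of the balls would not do: the heights of the Carleson
   squares are controlled because each ball lies in a single tripled ball. *)
have [D [uD Ds tD cov]] := vitali_lemma_finite ball_n ball_n0 s.
have selD n : n \in D -> selected C t n.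
  by move=> /Ds; rewrite mem_filter => /andP[/asboolP].
set k : R := 3 * 3 `^ (alpha + 1) * C.
have k0 : 0 <= k by rewrite mulr_ge0// mulr_ge0// powR_ge0.
have mQ3 n : measurable (carleson (rat_ball3 n : set R)).
  exact: measurable_carleson (nondeg_rat_ball3 n).
have mQ n : measurable (carleson (rat_ball n : set R)).
  exact: measurable_carleson (nondeg_rat_ball n).
pose g z := (tail_at t z * rat_maximal alpha w z)%E.
have g0 z : (0 <= g z)%E.
  by rewrite mule_ge0 ?tail_at_ge0 ?rat_maximal_ge0.
have mg (E : set (plane R)) : measurable E -> E `<=` upper_half ->
    measurable_fun E (fun z => g z * (z.2 `^ alpha)%:E)%E.
  move=> mE EH; apply: measurable_intV_integrand.
  apply: emeasurable_funM; first exact: measurable_tail_at.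
  exact: measurable_rat_maximal.
have gV0 z : (0 <= g z * (z.2 `^ alpha)%:E)%E.
  by rewrite mule_ge0// lee_fin powR_ge0.
have x0 n : (0 <= k%:E * intV alpha (carleson (rat_ball n)) g)%E.
  by rewrite mule_ge0 ?lee_fin// intV_ge0.
have r0 : 0 <= r := le_trans ler01 r1.
have UH : \big[setU/set0]_(j <- D) carleson (rat_ball j : set R) `<=` upper_half.
  by move=> z; rewrite -bigcup_seq => -[j _]; exact: carleson_sub_upper_half.
have mU : measurable (\big[setU/set0]_(j <- D) carleson (rat_ball j : set R)).
  exact: bigsetU_measurable.
apply: (@le_trans _ _ (mu (\big[setU/set0]_(j <- D) carleson (rat_ball3 j)))).
  apply: le_measure; rewrite ?inE.
  - exact: measurable_selected_union.
  - exact: bigsetU_measurable.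
  move=> z [n [/= nK seln] Qz].
  have /cov[j [jD _ _]] : n \in s.
    by rewrite mem_filter mem_iota; apply/andP; split; first exact/asboolP.
  rewrite scale_ballE// => sub.
  rewrite -bigcup_seq; exists j => //.
  by apply: subset_carleson Qz => //; [exact: nondeg_rat_ball|exact: nondeg_rat_ball3].
apply: le_trans (measure_bigsetU_le mu D mQ3) _.
apply: (@le_trans _ _ (\sum_(j <- D) C1%:E *
    (k%:E * intV alpha (carleson (rat_ball j)) g) `^ r)%E).
  rewrite big_seq [leRHS]big_seq; apply: lee_sum => j jD.
  apply: le_trans (hmu _ (nondeg_rat_ball3 j)) _.
  apply: lee_wpmul2l; first by rewrite lee_fin.
  by apply: le_poweR; rewrite ?Vw_ge0//; exact: Vw_ball3_le (selD _ jD).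
rewrite -ge0_sume_distrr; last by move=> j _; exact: poweR_ge0.
apply: lee_wpmul2l; first by rewrite lee_fin.
apply: le_trans (sum_poweR_le _ r1 x0) _.
apply: le_poweR => //; first by rewrite sume_ge0.
rewrite -ge0_sume_distrr; last by move=> j _; exact: intV_ge0.
apply: lee_wpmul2l; first by rewrite lee_fin.
(* Squares over disjoint balls are disjoint, so the integrals add up to a single one over their
   union. *)
rewrite /intV -ge0_integral_bigsetU//; last 2 first.
- apply/trivIsetP => i j iD jD ij; apply/seteqP; split => // z [[iz _] [jz _]].
  move/trivIsetP : tD => /(_ i j iD jD ij) tij.
  by have : (rat_ball i `&` rat_ball j) z.1 by []; rewrite tij.
- exact: mg.
apply: ge0_subset_integral => //; first exact: measurable_upper_half.
by apply: mg => //; exact: measurable_upper_half.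
Qed.

End WeakType.

(** * Dyadic levels and a measurable majorant *)

Lemma lt_expr2_trunc {R : realType} (x : R) : x < 2 ^+ (Num.trunc x).+1.
Proof.
apply: lt_le_trans (truncnS_gt _) _.
by rewrite -natrX ler_nat ltnW// ltn_expl.
Qed.

Section DyadicLevels.
Context {R : realType}.
Variables (alpha q : R) (Phi : R -> R) (f : plane R -> R[i]).
Hypotheses (alpha_gt : -1 < alpha) (hY : young Phi) (q1 : 1 <= q).
Hypothesis mf : measurable_cfun upper_half f.

(** The level 2^{i-K}, with natural exponents only: for [i] from 0 to 2K the levels run from 2^{-K}
    to 2^K. *)
Definition dyadic (K i : nat) : R := (2 ^+ K)^-1 * 2 ^+ i.

Lemma dyadic_gt0 K i : 0 < dyadic K i.
Proof. by rewrite mulr_gt0 ?invr_gt0 ?exprn_gt0. Qed.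

Lemma dyadicD K i n : dyadic (K + n) (i + n) = dyadic K i.
Proof.
by rewrite /dyadic !exprD; field; rewrite !expf_neq0.
Qed.

Lemma dyadicS K i : dyadic K i.+1 = 2 * dyadic K i.
Proof. by rewrite /dyadic exprS mulrCA. Qed.

(** Where the maximal function lies above t and is at most 2t, the term of level t alone dominates
    its [q]-th power once [K] is large. The range of levels and the number of balls grow with the
    same [K], so one monotone limit is enough. *)
Definition dyadic_majorant (K : nat) (z : plane R) : \bar R :=
  (\sum_(i < K.*2.+1) ((2 * dyadic K i) `^ q)%:E *
     (\1_(selected_union alpha Phi f (cover_const alpha) (dyadic K i) K) z)%:E)%E.

Let term_ge0 (C t : R) (K : nat) (z : plane R) :
  (0 <= ((2 * t) `^ q)%:E * (\1_(selected_union alpha Phi f C t K) z)%:E)%E.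
Proof. by rewrite mule_ge0// lee_fin ?powR_ge0. Qed.

Lemma dyadic_majorant_ge0 K z : (0 <= dyadic_majorant K z)%E.
Proof. by apply: sume_ge0 => i _; exact: term_ge0. Qed.

Lemma measurable_dyadic_majorant K (E : set (plane R)) :
  measurable_fun E (dyadic_majorant K).
Proof.
apply: emeasurable_sum => i; apply: emeasurable_funM => //.
apply/measurable_EFinP; apply: measurable_indic.
exact: measurable_selected_union.
Qed.

(** Passing from [K] to [K.+1] enlarges every union, shifts the old levels by one index and adds a
    new level at either end. *)
Lemma dyadic_majorant_nd z : nondecreasing_seq (dyadic_majorant ^~ z).
Proof.
apply/nondecreasing_seqP => K; rewrite /dyadic_majorant doubleS.
rewrite [leRHS]big_ord_recl [X in (_ + X)%E]big_ord_recr/=.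
apply: (@le_trans _ _ (\sum_(i < K.*2.+1) ((2 * dyadic K i) `^ q)%:E *
  (\1_(selected_union alpha Phi f (cover_const alpha) (dyadic K i) K.+1) z)%:E)%E).
  apply: lee_sum => i _; apply: lee_wpmul2l; first by rewrite lee_fin powR_ge0.
  rewrite lee_fin !indicE; have [zK|_] := boolP (z \in _); last by [].
  rewrite mem_set//; move/set_mem : zK => [n [nK seln] Qz].
  by exists n => //; split => //=; exact: ltnW.
rewrite -[leLHS]add0e; apply: leeD; first exact: term_ge0.
rewrite -[leLHS]adde0; apply: leeD; last exact: term_ge0.
apply: lee_sum => i _.
have -> : dyadic K.+1 (bump 0 i) = dyadic K i.
  by rewrite /bump leq0n add1n -[K.+1]addn1 -[i.+1]addn1 dyadicD.
by [].
Qed.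

Lemma lux_norm_ge0 I : (0 <= lux_norm Phi alpha I f)%E.
Proof.
by apply: le_ereal_inf_tmp => _ [l [l0 _] <-]; rewrite lee_fin ltW.
Qed.

(** A supremum over no interval would be minus infinity. The ball of centre [z.1] and radius [z.2]
    has length twice the height of [z], so its square contains [z]. *)
Lemma orlicz_maximal_ge0 z : upper_half z -> (0 <= orlicz_maximal Phi alpha f z)%E.
Proof.
move=> z0; apply: (le_trans (lux_norm_ge0 (ball z.1 z.2))).
apply: ereal_sup_ubound; exists (ball z.1 z.2) => //; split.
  exact: nondeg_ball.
split; first exact: ballxx.
rewrite fine_measure_ball// (z0 : 0 < z.2)/=.
by move: z0; rewrite /upper_half/=; lra.
Qed.

Let level_le K i z :
  ((dyadic K i)%:E < orlicz_maximal Phi alpha f z)%E ->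
  (((2 * dyadic K i) `^ q)%:E <= limn (dyadic_majorant ^~ z))%E.
Proof.
move=> /ereal_sup_gt[_ [I [nI Qz] <-] tlt].
have [n Qnz seln] := lux_norm_selected alpha_gt hY mf (dyadic_gt0 K i) nI Qz tlt.
(* The same level occurs in the majorant of index [K + m], at position [i + m]. The summand [i] puts
   this position in range, the summand [n.+1] admits the ball [n]. *)
pose m := (i + n.+1)%N.
have im : (i + m < (K + m).*2.+1)%N.
  by rewrite /m -addnn; lia.
have -> : limn (dyadic_majorant ^~ z) = ereal_sup (range (dyadic_majorant ^~ z)).
  exact/cvg_lim/ereal_nondecreasing_cvgn/dyadic_majorant_nd.
apply: le_trans (ereal_sup_ubound _); last by exists (K + m)%N.
rewrite /dyadic_majorant (bigD1 (Ordinal im))//= dyadicD indicE mem_set.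
  by rewrite mule1 leeDl// sume_ge0// => j _; exact: term_ge0.
by exists n => //; split => //=; rewrite /m; lia.
Qed.

Lemma orlicz_maximal_le_majorant z : upper_half z ->
  (orlicz_maximal Phi alpha f z `^ q <= limn (dyadic_majorant ^~ z))%E.
Proof.
move=> Hz; have q0 : 0 < q := lt_le_trans ltr01 q1.
have lim0 : (0 <= limn (dyadic_majorant ^~ z))%E.
  apply: lime_ge; first exact/ereal_nondecreasing_is_cvgn/dyadic_majorant_nd.
  by apply: nearW => K; exact: dyadic_majorant_ge0.
have := orlicz_maximal_ge0 Hz; have := fun K i => @level_le K i z.
case: (orlicz_maximal _ _ _ _) => [x| |] level //.
- rewrite lee_fin le_eqVlt => /predU1P[<-|x0].
    by rewrite poweR_EFin powR0// gt_eqF.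
  have [N Nx] : exists N, dyadic N 0 < x.
    exists (Num.trunc x^-1).+1; rewrite /dyadic expr0 mulr1 invf_plt ?posrE ?exprn_gt0//.
    exact: lt_expr2_trunc.
  have [M xM] : exists M, x <= dyadic N M.
    exists (Num.trunc (x * 2 ^+ N)).+1; rewrite /dyadic mulrC ler_pdivlMr ?exprn_gt0//.
    exact/ltW/lt_expr2_trunc.
  (* The least level that is at least [x] is not the lowest one, by the choice of [N]; the level
     just below it is then less than [x], and its double is at least [x]. *)
  have [j xj jmin] := ex_minnP (ex_intro (fun M => x <= dyadic N M) M xM).
  case: j xj jmin => [xj|j xj jmin]; first by move: (lt_le_trans Nx xj); rewrite ltxx.
  have jx : dyadic N j < x.
    by rewrite ltNge; apply/negP => /jmin; rewrite ltnn.
  apply: le_trans (level N j _); last by rewrite lte_fin.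
  rewrite poweR_EFin lee_fin -dyadicS ge0_ler_powR ?nnegrE ?(ltW q0) ?(ltW x0)//.
  by rewrite ltW// dyadic_gt0.
(* An infinite value exceeds all levels, so the limit dominates the [q]-th powers of arbitrarily
   large numbers. *)
- rewrite poweRyr ?gt_eqF// => _; rewrite leye_eq; apply/eqP/eqyP => A A0.
  pose j := (Num.trunc A).+1.
  apply: le_trans (level 0%N j _); last by rewrite ltry.
  rewrite lee_fin /dyadic expr0 invr1 mul1r.
  have Aj : A <= 2 * 2 ^+ j.
    apply: ltW; apply: lt_le_trans (lt_expr2_trunc A) _.
    by rewrite ler_peMl ?exprn_ge0// ler1n.
  apply: le_trans Aj _; rewrite -[leLHS]powRr1 ?mulr_ge0 ?exprn_ge0//.
  by rewrite ler_powR// -exprS exprn_ege1// ler1n.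
Qed.

End DyadicLevels.

(** * Summation over levels, with a bound uniform in [K] *)

Lemma integral_dyadic_majorant {R : realType} (alpha p q : R) (Phi : R -> R)
    (w : plane R -> R) (mu : {measure set (plane R) -> \bar R}) (C1 : R) :
  -1 < alpha -> 0 < p -> p <= q -> B_class p Phi -> weight w -> 0 < C1 ->
  (forall I : set R, nondeg_interval I ->
    mu (carleson I) <= C1%:E * Vw w alpha (carleson I) `^ (q / p))%E ->
  exists2 B : R, 0 < B & forall f : plane R -> R[i],
    measurable_cfun upper_half f -> forall K : nat,
    (\int[mu]_(z in upper_half) dyadic_majorant alpha q Phi f K z <=
     B%:E * intV alpha upper_half
       (fun z => (modulus (f z) `^ p)%:E * rat_maximal alpha w z) `^ (q / p))%E.
Proof.
move=> a1 p0 pq hB hw C10 hmu.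
have hY : young Phi by case: hB.
have q0 : 0 < q := lt_le_trans p0 pq.
set r := q / p in hmu *.
have r1 : 1 <= r by rewrite ler_pdivlMr// mul1r.
have r0 : 0 <= r := le_trans ler01 r1.
have [S S0 hS] := B_class_sum (ltW p0) hB.
have C0 : 0 < cover_const alpha by rewrite !mulr_gt0// powR_gt0.
pose k : R := 3 * 3 `^ (alpha + 1) * cover_const alpha.
have k0 : 0 < k by rewrite !mulr_gt0// powR_gt0.
(* [C1] comes from the hypothesis on [mu], 2^q from the doubled levels in the majorant, [k] from the
   covering and [S] from the B_p condition. *)
exists (C1 * 2 `^ q * (k * S) `^ r).
  by rewrite !mulr_gt0// powR_gt0// mulr_gt0.
move=> f mf K.
have mH := @measurable_upper_half R.
pose M := rat_maximal alpha w.
have M0 z : (0 <= M z)%E by exact: rat_maximal_ge0.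
have mM : measurable_fun upper_half M by exact: measurable_rat_maximal.
pose t i := dyadic (R := R) K i.
have t0 i : 0 < t i by exact: dyadic_gt0.
pose T i z : \bar R := (tail_at Phi f (t i) z * M z)%E.
have T0 i z : (0 <= T i z)%E by rewrite mule_ge0// tail_at_ge0.
have mT i : measurable_fun upper_half (T i).
  by apply: emeasurable_funM => //; exact: measurable_tail_at.
rewrite [leLHS]ge0_integral_sum//; last 2 first.
- move=> i; apply: emeasurable_funM => //.
  apply/measurable_EFinP; apply: measurable_indic.
  exact: measurable_selected_union.
- by move=> i z _; rewrite mule_ge0// lee_fin ?powR_ge0.
apply: (@le_trans _ _ (\sum_(i < K.*2.+1) (C1 * 2 `^ q)%:E *
    ((k * t i `^ p)%:E * intV alpha upper_half (T i)) `^ r)%E).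
  apply: lee_sum => i _; rewrite ge0_integralZl//; last 2 first.
  - apply/measurable_EFinP; apply: measurable_indic.
    exact: measurable_selected_union.
  - by rewrite lee_fin powR_ge0.
  rewrite integral_indic//; last exact: measurable_selected_union.
  rewrite setIidl; last exact: selected_union_sub.
  have := weak_type a1 hY hw mf (t i) K (ltW C10) (ltW C0) r1 hmu.
  rewrite -/k => hweak.
  apply: (@le_trans _ _ (((2 * t i) `^ q)%:E *
     (C1%:E * (k%:E * intV alpha upper_half (T i)) `^ r))%E).
    by apply: lee_wpmul2l => //; rewrite lee_fin powR_ge0.
  have I0 : (0 <= intV alpha upper_half (T i))%E by exact: intV_ge0.
  (* Because [p * r = q], the factor t^q is the [r]-th power of t^p and can be carried inside the
     power. *)
  rewrite powRM ?(ltW (t0 i))//.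
  rewrite [(k * t i `^ p)%:E]EFinM -(muleA k%:E) (muleCA k%:E).
  rewrite [in leRHS]poweRM ?lee_fin ?powR_ge0//; last first.
    by rewrite mule_ge0// lee_fin ltW.
  rewrite poweR_EFin -powRrM (_ : p * r = q); last first.
    by rewrite /r mulrCA mulfV ?mulr1// gt_eqF.
  by rewrite !EFinM muleACA (muleC (2 `^ q)%:E).
rewrite -ge0_sume_distrr; last by move=> i _; exact: poweR_ge0.
have I0 (i : 'I_(K.*2.+1)) : (0 <= (k * t i `^ p)%:E * intV alpha upper_half (T i))%E.
  by rewrite mule_ge0 ?intV_ge0// lee_fin mulr_ge0 ?powR_ge0// ltW.
rewrite (EFinM (C1 * 2 `^ q)) -muleA.
apply: lee_wpmul2l; first by rewrite lee_fin mulr_ge0 ?powR_ge0// ltW.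
apply: le_trans (sum_poweR_le _ r1 I0) _.
set W := intV _ _ _.
have W0 : (0 <= W)%E.
  by apply: intV_ge0 => z _; rewrite mule_ge0// lee_fin powR_ge0.
rewrite -poweR_EFin -poweRM ?lee_fin ?mulr_ge0 ?(ltW k0) ?(ltW S0)//.
apply: le_poweR => //; first by apply: sume_ge0 => i _; exact: I0.
under eq_bigr do rewrite EFinM -muleA.
rewrite -ge0_sume_distrr; last first.
  by move=> i _; rewrite mule_ge0 ?intV_ge0// lee_fin powR_ge0.
rewrite (EFinM k S) -muleA.
apply: lee_wpmul2l; first by rewrite lee_fin ltW.
have -> : (\sum_(i < K.*2.+1) (t i `^ p)%:E * intV alpha upper_half (T i))%E =
    intV alpha upper_half (fun z => (\sum_(i < K.*2.+1)
      (t i `^ p * Phi_tail Phi (modulus (f z) / t i)))%:E * M z)%E.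
  have -> : (\sum_(i < K.*2.+1) (t i `^ p)%:E * intV alpha upper_half (T i) =
      \sum_(i < K.*2.+1) \int[area]_(z in upper_half)
        (T i z * (t i `^ p)%:E * (z.2 `^ alpha)%:E))%E.
    apply: eq_bigr => i _; rewrite muleC -intVZr// lee_fin powR_ge0//.
  rewrite -ge0_integral_sum//.
  - apply: eq_integral => z _; rewrite -sumEFin.
    rewrite ge0_sume_distrl; last first.
      by move=> i _; rewrite lee_fin mulr_ge0 ?powR_ge0 ?Phi_tail_ge0.
    rewrite ge0_sume_distrl; last first.
      move=> i _; rewrite mule_ge0// lee_fin mulr_ge0 ?powR_ge0//.
      exact: Phi_tail_ge0.
    apply: eq_bigr => i _; congr (_ * _)%E.
    by rewrite /T muleAC EFinM [in RHS](muleC (t i `^ p)%:E).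
  - move=> i; apply: measurable_intV_integrand.
    by apply: emeasurable_funM.
  - by move=> i z _; apply: mule_ge0; [apply: mule_ge0 => //|]; rewrite lee_fin powR_ge0.
have -> : (S%:E * W = intV alpha upper_half
     (fun z => (modulus (f z) `^ p)%:E * M z * S%:E))%E.
  rewrite intVZr ?(ltW S0) 1?muleC//; last by rewrite lee_fin ltW.
  - apply: emeasurable_funM => //; apply/measurable_EFinP.
    apply: (measurableT_comp (measurable_powR p)).
    exact: measurable_modulus.
  - by move=> z _; rewrite mule_ge0// lee_fin powR_ge0.
apply: le_intV => z Hz.
  rewrite mule_ge0// lee_fin sumr_ge0// => i _.
  by rewrite mulr_ge0 ?powR_ge0 ?Phi_tail_ge0.
rewrite muleAC; apply: lee_wpmul2r => //.
(* The levels [t i] are those of [hS] with lowest level 2^{-K}. *)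
rewrite -EFinM lee_fin mulrC; apply: hS; first exact: modulus_ge0.
by rewrite invr_gt0 exprn_gt0.
Qed.

(** * Passage to the limit in the number of levels *)

Theorem theorem1p5 (R : realType) (alpha p q : R) (Phi : R -> R)
    (mu : {measure set (plane R) -> \bar R}) (w : plane R -> R)
    (halpha : -1 < alpha) (hp : 1 < p) (hpq : p <= q)
    (hPhi : B_class p Phi) (hw : weight w)
    (hmu : exists2 C1 : R, 0 < C1 & forall I : set R, nondeg_interval I ->
      (mu (carleson I) <= C1%:E * Vw w alpha (carleson I) `^ (q / p))%E) :
  exists2 C2 : R, 0 < C2 &
    forall f : plane R -> R[i], measurable_cfun upper_half f ->
      ((\int[mu]_(z in upper_half) orlicz_maximal Phi alpha f z `^ q) `^ q^-1
       <= C2%:E * intV alpha upper_half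
            (fun z => (modulus (f z) `^ p)%:E * maximal alpha w z) `^ p^-1)%E.
Proof.
have [C1 C10 hC1] := hmu.
have p0 : 0 < p := lt_trans ltr01 hp.
have q0 : 0 < q := lt_le_trans p0 hpq.
have q1 : 1 <= q := le_trans (ltW hp) hpq.
have hY : young Phi by case: hPhi.
have [B B0 hB] := integral_dyadic_majorant halpha p0 hpq hPhi hw C10 hC1.
exists (B `^ q^-1) => [|f mf]; first exact: powR_gt0.
have mH := @measurable_upper_half R.
set W := intV _ _ _.
pose W' := intV alpha upper_half
  (fun z => (modulus (f z) `^ p)%:E * rat_maximal alpha w z)%E.
have W'0 : (0 <= W')%E.
  by apply: intV_ge0 => z _; rewrite mule_ge0 ?rat_maximal_ge0// lee_fin powR_ge0.
have W'W : (W' <= W)%E.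
  apply: le_intV => z _.
    by rewrite mule_ge0 ?rat_maximal_ge0// lee_fin powR_ge0.
  by apply: lee_wpmul2l; [rewrite lee_fin powR_ge0|exact: rat_maximal_le].
have -> : (B `^ q^-1)%:E = (B%:E `^ q^-1)%E by rewrite poweR_EFin.
(* Both sides become powers of exponent [q^-1], which can then be removed. *)
have -> : (W `^ p^-1 = (W `^ (q / p)) `^ q^-1)%E.
  by rewrite -poweRrM mulrAC mulfV ?mul1r// gt_eqF.
rewrite -poweRM ?lee_fin ?(ltW B0) ?poweR_ge0//.
apply: le_poweR; first by rewrite invr_ge0 ltW.
  by apply: integral_ge0 => z _; exact: poweR_ge0.
apply: (@le_trans _ _ (\int[mu]_(z in upper_half)
    limn (dyadic_majorant alpha q Phi f ^~ z))%E).
  apply: ge0_le_integral_nomeas => z Hz; first exact: poweR_ge0.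
  exact: orlicz_maximal_le_majorant.
(* The limit leaves the integral, and [B] bounds the integral for every [K]; [W'W] then replaces the
   countable maximal function of the weight by the full one. *)
rewrite monotone_convergence//; last 3 first.
- by move=> K; exact: measurable_dyadic_majorant.
- by move=> K z _; exact: dyadic_majorant_ge0.
- by move=> z _; exact: dyadic_majorant_nd.
apply: lime_le.
  apply: ereal_nondecreasing_is_cvgn => m n mn; apply: ge0_le_integral => //.
  - by move=> z _; exact: dyadic_majorant_ge0.
  - exact: measurable_dyadic_majorant.
  - exact: measurable_dyadic_majorant.
  - by move=> z _; exact: dyadic_majorant_nd.
apply: nearW => K; apply: le_trans (hB f mf K) _.
apply: lee_wpmul2l; first by rewrite lee_fin ltW.
by apply: le_poweR => //; rewrite divr_ge0// ltW.
Qed.
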